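(* Let $d\ge1$ and let $\gamma_1,\gamma_2$ be two finite paths on the lattice $\mathbb{Z}^d$ starting at $0$. Then $\gamma_1$ and $\gamma_2$ are $Sol_d$-equivalent (i.e. they define the same element of the free solvable group of level two $Sol_d$) if and only if $\gamma_1(\rho)=\gamma_2(\rho)$ for every edge $\rho$ of the lattice.
   Context: $Sol_d=F_d/(F_d)''$, where $F_d$ is the free group on $d$ generators and $(F_d)''$ its second commutator subgroup; $x_1,\dots,x_d$ are the canonical generators of $Sol_d$. The lattice is considered as the Cayley graph of $\mathbb{Z}^d$ with standard basis $e_1,\dots,e_d$. A finite word $s_1s_2\cdots s_n$ in the letters $x_i^{\pm1}$ is identified with the edge path of length $n$ starting at $0$ whose $k$-th step is $+e_i$ if $s_k=x_i$ and $-e_i$ if $s_k=x_i^{-1}$; conversely each finite edge path starting at $0$ comes from a unique word. The element of $Sol_d$ defined by a path is the value in $Sol_d$ of the corresponding word; two paths are $Sol_d$-equivalent if they define the same element of $Sol_d$. For a path $\gamma$ and an edge $\rho$, $\gamma(\rho)\in\mathbb{Z}$ is the algebraic sum of all occurrences of $\rho$ in $\gamma$: each traversal of $\rho$ in the positive coordinate direction counts $+1$ and each traversal in the opposite direction counts $-1$. *)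

(* Defs.v *)
From HB Require Import structures.
From mathcomp Require Import all_boot all_order all_algebra.
From mathcomp Require Import boolp classical_sets.

Set Implicit Arguments.
Unset Strict Implicit.
Unset Printing Implicit Defensive.

Import GRing.Theory.

(* The letter (x, true) stands for x and (x, false) for its inverse. *)
Notation letter T := (T * bool)%type.
Notation word T := (seq (letter T)).

Section FreeGroup.
Variable T : choiceType.
Implicit Types (a b : letter T) (u v w : word T).

Definition linv a : letter T := (a.1, ~~ a.2).

Lemma linvK : involutive linv.
Proof. by case=> x b; rewrite /linv /= negbK. Qed.

Definition reduced w : bool := sorted (fun a b => b != linv a) w.

Definition push a w : word T :=
  if w is b :: w' then if b == linv a then w' else a :: w else [:: a].

Definition reduce w : word T := foldr push [::] w.

Definition word_inv w : word T := rev (map linv w).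

Lemma reduced_behead a w : reduced (a :: w) -> reduced w.
Proof. exact: path_sorted. Qed.

Lemma push_reduced a w : reduced w -> reduced (push a w).
Proof.
case: w => [|b w] //= rw; case: ifP => [_|ba]; first exact: path_sorted rw.
by rewrite /reduced /= ba.
Qed.

Lemma foldr_push_reduced u w : reduced w -> reduced (foldr push w u).
Proof. by move=> rw; elim: u => //= a u; apply: push_reduced. Qed.

Lemma reduce_reduced w : reduced (reduce w).
Proof. exact: foldr_push_reduced. Qed.

Lemma reduce_id w : reduced w -> reduce w = w.
Proof.
elim: w => //= a w IHw rw; rewrite IHw; last exact: reduced_behead rw.
by case: w {IHw} rw => //= b w /andP[/negPf-> _].
Qed.

Lemma pushK a w : reduced w -> push a (push (linv a) w) = w.
Proof.
case: w => [|b w] /=; first by rewrite eqxx.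
rewrite linvK; case: ifP => [/eqP-> | _ _] /=; last by rewrite eqxx.
by case: w => //= c w /andP[/negPf-> _].
Qed.

Lemma foldr_push_reduce u w :
  reduced w -> foldr push w (reduce u) = foldr push w u.
Proof.
move=> rw; elim: u => //= a u IHu; rewrite -IHu.
case: (reduce u) => //= b t; case: ifP => //= /eqP->.
by rewrite pushK //; apply: foldr_push_reduced.
Qed.

Lemma reduce_catr u w : reduce (u ++ reduce w) = reduce (u ++ w).
Proof.
by rewrite /reduce !foldr_cat -/(reduce w) -/(reduce (reduce w))
           (reduce_id (reduce_reduced w)).
Qed.

Lemma reduce_catl u w : reduce (reduce u ++ w) = reduce (u ++ w).
Proof.
by rewrite {1 3}/reduce !foldr_cat foldr_push_reduce // reduce_reduced.
Qed.

Lemma word_invK : involutive word_inv.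
Proof. by move=> w; rewrite /word_inv map_rev revK mapK //; apply: linvK. Qed.

Lemma reduced_inv w : reduced w -> reduced (word_inv w).
Proof.
rewrite /reduced /word_inv rev_sorted sorted_map.
by apply: sub_sorted => a b /=; apply: contraNneq => ->; rewrite !linvK.
Qed.

Lemma reduce_mulV w : reduce (w ++ word_inv w) = [::].
Proof.
elim: w => // a w IHw; rewrite /word_inv /= rev_cons -cats1 catA -/(word_inv w).
by rewrite -reduce_catl IHw /= eqxx.
Qed.

Lemma reduce_Vmul w : reduce (word_inv w ++ w) = [::].
Proof. by rewrite -{2}(word_invK w) reduce_mulV. Qed.

Record freeGroup := FreeGroup { fgword :> word T; _ : reduced fgword }.

HB.instance Definition _ := [isSub for fgword].
HB.instance Definition _ := [Choice of freeGroup by <:].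
Implicit Types g h k : freeGroup.

Definition fgone : freeGroup := @FreeGroup [::] isT.
Definition fgmul g h : freeGroup :=
  FreeGroup (reduce_reduced (fgword g ++ fgword h)).
Definition fginv g : freeGroup := FreeGroup (reduced_inv (valP g)).

Lemma fgmulA : associative fgmul.
Proof.
by move=> g h k; apply: val_inj; rewrite /= reduce_catr reduce_catl catA.
Qed.

Lemma fgmul1g : left_id fgone fgmul.
Proof. by move=> g; apply: val_inj; apply: reduce_id (valP g). Qed.

Lemma fgmulg1 : right_id fgone fgmul.
Proof.
by move=> g; apply: val_inj; rewrite /= cats0; apply: reduce_id (valP g).
Qed.

Lemma fgmulVg : left_inverse fgone fginv fgmul.
Proof. by move=> g; apply: val_inj; apply: reduce_Vmul. Qed.

Lemma fgmulgV : right_inverse fgone fginv fgmul.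
Proof. by move=> g; apply: val_inj; apply: reduce_mulV. Qed.

HB.instance Definition _ :=
  isGroup.Build freeGroup fgmulA fgmul1g fgmulg1 fgmulVg fgmulgV.

Definition fggen (x : T) : freeGroup := @FreeGroup [:: (x, true)] isT.

End FreeGroup.

Section EvalWord.
Local Open Scope group_scope.
Variables (T : choiceType) (G : groupType) (f : T -> G).

Definition eval_letter (a : letter T) : G := if a.2 then f a.1 else (f a.1)^-1.

Definition eval_word (w : word T) : G := \prod_(a <- w) eval_letter a.

Lemma eval_word_cat u v : eval_word (u ++ v) = eval_word u * eval_word v.
Proof. by rewrite /eval_word big_cat. Qed.

Lemma eval_reduce w : eval_word (reduce w) = eval_word w.
Proof.
elim: w => //= a w IHw; rewrite /eval_word big_cons -!/(eval_word _) -IHw.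
case: (reduce w) => [|b v] /=; first by rewrite /eval_word big_seq1 big_nil mulg1.
case: eqP => [->|_]; rewrite /eval_word !big_cons //.
rewrite mulgA; suff ->: eval_letter a * eval_letter (linv a) = 1 by rewrite mul1g.
by case: a => x []; rewrite /eval_letter /= (mulgV, mulVg).
Qed.

(* The universal property of the free group: existence, then uniqueness. *)
Lemma freeGroup_lift :
  let phi (g : freeGroup T) := eval_word (fgword g) in
  {morph phi : g h / g * h} /\ forall x, phi (fggen x) = f x.
Proof.
split=> [g h|x]; first by rewrite /= eval_reduce eval_word_cat.
by rewrite /eval_word big_seq1.
Qed.

End EvalWord.

Lemma freeGroup_word (T : choiceType) (g : freeGroup T) :
  g = eval_word (@fggen T) (fgword g).
Proof.
have E (w : word T) : fgword (eval_word (@fggen T) w) = reduce w.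
  elim: w => [|a w IHw]; first by rewrite /eval_word big_nil.
  rewrite /eval_word big_cons -/(eval_word _ _) /= IHw.
  by rewrite [LHS]reduce_catr; case: a => x [].
by apply: val_inj; rewrite /= E reduce_id //; apply: valP.
Qed.

Section Subgroups.
Local Open Scope group_scope.
Local Open Scope classical_set_scope.
Variable G : groupType.
Implicit Types A B H : set G.

Definition is_subgroup H : Prop := group_closed [in H].

Lemma subgroupP H :
  is_subgroup H <->
  [/\ H 1, forall x y, H x -> H y -> H (x * y) & forall x, H x -> H x^-1].
Proof.
split=> [[H1 HD]|[H1 HM HV]].
  have HV x : H x -> H x^-1.
    by move=> Hx; rewrite -[x^-1]mul1g -in_setE; apply: HD => //; rewrite inE.
  split=> // [|x y Hx Hy]; first by rewrite -in_setE.
  by rewrite -[y]invgK -in_setE; apply: HD; rewrite inE //; apply: HV.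
split=> [|x y]; rewrite !inE // => Hx Hy.
by apply: HM => //; apply: HV.
Qed.

(* The subgroup generated by A: the intersection of the subgroups above A. *)
Definition gen A : set G := smallest is_subgroup A.

Definition commutator_subgroup A B : set G :=
  gen [set [~ x, y] | x in A & y in B].

Definition derived_subgroup A : set G := commutator_subgroup A A.

Definition is_normal_subgroup H : Prop :=
  is_subgroup H /\ forall x y, H x -> H (x ^ y).

Lemma subgroup_gen A : is_subgroup (gen A).
Proof.
apply/subgroupP; split=> [B [/subgroupP[]]//|x y Ax Ay B AB|x Ax B AB].
  by case: (AB) => /subgroupP[_ BM _] _; apply: BM; [apply: Ax|apply: Ay].
by case: (AB) => /subgroupP[_ _ BV] _; apply: BV; apply: Ax.
Qed.

Lemma normal_derived H :
  is_normal_subgroup H -> is_normal_subgroup (derived_subgroup H).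
Proof.
move=> [_ nH]; split=> [|x y Hx]; first exact: subgroup_gen.
suff: [set z | derived_subgroup H (z ^ y)] x by [].
apply: Hx; split.
  have /subgroupP[D1 DM DV] := subgroup_gen [set [~ u, v] | u in H & v in H].
  apply/subgroupP; split=> /= [|u v Du Dv|u Du].
  - by rewrite conj1g.
  - by rewrite conjMg; apply: DM.
  - by rewrite conjVg; apply: DV.
move=> _ [u Hu [v Hv <-]] /=; rewrite conjRg => B [_]; apply.
by exists (u ^ y); [exact: nH | exists (v ^ y); first exact: nH].
Qed.

Lemma normal_setT : is_normal_subgroup setT.
Proof. by split=> //; apply/subgroupP. Qed.

Record normalSubgroup := NormalSubgroup {
  nsgset :> set G;
  nsgP : is_normal_subgroup nsgset }.

Variable N : normalSubgroup.

(* x N = y N *)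
Definition coset_rel : rel G := fun x y => `[< nsgset N (x^-1 * y) >].

Lemma coset_rel_refl : reflexive coset_rel.
Proof.
move=> x; apply/asboolP; rewrite mulVg.
by have [/subgroupP[]] := nsgP N.
Qed.

Lemma coset_rel_sym : symmetric coset_rel.
Proof.
have [/subgroupP[_ _ NV] _] := nsgP N.
have H x y : coset_rel x y -> coset_rel y x.
  by move/asboolP/NV; rewrite invgM invgK => /asboolP.
by move=> x y; apply/idP/idP; apply: H.
Qed.

Lemma coset_rel_trans : transitive coset_rel.
Proof.
have [/subgroupP[_ NM _] _] := nsgP N.
move=> y x z /asboolP Nxy /asboolP Nyz; apply/asboolP.
by have := NM _ _ Nxy Nyz; rewrite mulgA mulgK.
Qed.

Canonical coset_equiv :=
  EquivRel coset_rel coset_rel_refl coset_rel_sym coset_rel_trans.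

Definition quotientGroup := {eq_quot coset_equiv}%qT.

HB.instance Definition _ := Choice.on quotientGroup.
HB.instance Definition _ := EqQuotient.on quotientGroup.

Definition quot_proj (x : G) : quotientGroup := (\pi_quotientGroup x)%qT.
Definition quot_one : quotientGroup := quot_proj 1.
Definition quot_mul (x y : quotientGroup) : quotientGroup :=
  quot_proj (repr x * repr y).
Definition quot_inv (x : quotientGroup) : quotientGroup :=
  quot_proj (repr x)^-1.

Lemma quot_projE x y : quot_proj x = quot_proj y <-> nsgset N (x^-1 * y).
Proof.
by split=> [/eqmodP/asboolP //|Nxy]; apply/eqmodP; apply/asboolP.
Qed.

Lemma quot_projK x : quot_proj (repr x) = x.
Proof. exact: reprK. Qed.

Lemma quot_projM x y : quot_mul (quot_proj x) (quot_proj y) = quot_proj (x * y).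
Proof.
have [/subgroupP[_ NM _] NJ] := nsgP N.
apply/quot_projE; set x' := repr _; set y' := repr _.
have /quot_projE Nx : quot_proj x' = quot_proj x by apply: quot_projK.
have /quot_projE Ny : quot_proj y' = quot_proj y by apply: quot_projK.
have -> : (x' * y')^-1 * (x * y) = (x'^-1 * x) ^ y' * (y'^-1 * y).
  by rewrite /conjg invgM !mulgA mulgK.
by apply: NM => //; apply: NJ.
Qed.

Lemma quot_projV x : quot_inv (quot_proj x) = quot_proj x^-1.
Proof.
have [/subgroupP[_ _ NV] NJ] := nsgP N.
apply/quot_projE; set x' := repr _.
have /quot_projE Nx : quot_proj x' = quot_proj x by apply: quot_projK.
have -> : x'^-1^-1 * x^-1 = ((x'^-1 * x) ^ x'^-1)^-1.
  by rewrite /conjg !invgM !invgK -!mulgA mulgV mulg1.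
by apply: NV; apply: NJ.
Qed.

Lemma quot_mulA : associative quot_mul.
Proof.
move=> x y z; rewrite -[x]quot_projK -[y]quot_projK -[z]quot_projK.
by rewrite !quot_projM mulgA.
Qed.

Lemma quot_mul1g : left_id quot_one quot_mul.
Proof. by move=> x; rewrite -[x]quot_projK quot_projM mul1g. Qed.

Lemma quot_mulg1 : right_id quot_one quot_mul.
Proof. by move=> x; rewrite -[x]quot_projK quot_projM mulg1. Qed.

Lemma quot_mulVg : left_inverse quot_one quot_inv quot_mul.
Proof. by move=> x; rewrite -[x]quot_projK quot_projV quot_projM mulVg. Qed.

Lemma quot_mulgV : right_inverse quot_one quot_inv quot_mul.
Proof. by move=> x; rewrite -[x]quot_projK quot_projV quot_projM mulgV. Qed.

HB.instance Definition _ := isGroup.Build quotientGroup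
  quot_mulA quot_mul1g quot_mulg1 quot_mulVg quot_mulgV.

End Subgroups.

Definition second_derived (d : nat) : normalSubgroup (freeGroup 'I_d) :=
  NormalSubgroup
    (normal_derived (normal_derived (@normal_setT (freeGroup 'I_d)))).

Definition Sol (d : nat) : groupType := quotientGroup (second_derived d).

Definition Sol_gen d (i : 'I_d) : Sol d :=
  quot_proj (second_derived d) (fggen i).

Section Lattice.
Local Open Scope ring_scope.
Variable d : nat.

Definition vertex := 'rV[int]_d.

Definition basis_vec (i : 'I_d) : vertex := delta_mx 0 i.

(* The pair (x, i) is the edge joining x and x + e_i. *)
Definition edge := (vertex * 'I_d)%type.

Definition step (a : letter 'I_d) : vertex :=
  if a.2 then basis_vec a.1 else - basis_vec a.1.

Definition adjacent (x y : vertex) : bool :=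
  [exists i : 'I_d, (y == x + basis_vec i) || (x == y + basis_vec i)].

(* A path of length n starting at 0 is recorded by its last n vertices; the
   initial vertex 0 is left implicit. *)
Record lattice_path := LatticePath {
  vertices :> seq vertex;
  _ : path adjacent 0 vertices }.

HB.instance Definition _ := [isSub for vertices].

Implicit Types p : lattice_path.

Definition oriented_steps p : seq (vertex * vertex) := zip (0 :: val p) (val p).

Definition flow p (rho : edge) : int :=
  let: (x, i) := rho in
  (count_mem (x, x + basis_vec i) (oriented_steps p))%:Z
  - (count_mem (x + basis_vec i, x) (oriented_steps p))%:Z.

Definition letter_of_step (e : vertex * vertex) : option (letter 'I_d) :=
  [pick a | e.2 == e.1 + step a].

Definition word_of_path p : word 'I_d := pmap letter_of_step (oriented_steps p).

Definition Sol_value p : Sol d := eval_word (@Sol_gen d) (word_of_path p).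

Definition Sol_equivalent p1 p2 : Prop := Sol_value p1 = Sol_value p2.

Fixpoint trace (x : vertex) (w : word 'I_d) : seq vertex :=
  if w is a :: w' then x + step a :: trace (x + step a) w' else [::].

Lemma step_inj : injective step.
Proof.
move=> [i b] [j c] /matrixP/(_ 0) E.
have := E i; have := E j; rewrite /step /basis_vec /=.
by case: b c {E} => [] [] /=; rewrite !mxE !eqxx /= (eq_sym j i);
   case: eqP => [->|].
Qed.

Lemma adjacentP x y :
  reflect (exists a, y = x + step a) (adjacent x y).
Proof.
apply: (iffP existsP) => [[i /orP[] /eqP E]|[[i b] E]].
- by exists (i, true).
- by exists (i, false); rewrite E /step /= addrK.
- by exists i; rewrite E /step; case: b {E} => /=; rewrite ?subrK eqxx ?orbT.
Qed.

Lemma letter_of_stepE x a : letter_of_step (x, x + step a) = Some a.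
Proof.
rewrite /letter_of_step; case: pickP => [b|/(_ a)] /=; last by rewrite eqxx.
by move/eqP/addrI/step_inj->.
Qed.

Lemma trace_path x w : path adjacent x (trace x w).
Proof.
by elim: w x => //= a w IHw x; rewrite IHw andbT; apply/adjacentP; exists a.
Qed.

Definition path_of_word (w : word 'I_d) : lattice_path :=
  LatticePath (trace_path 0 w).

(* Words and edge paths starting at 0 are in bijection. *)
Lemma path_of_wordK : cancel path_of_word word_of_path.
Proof.
rewrite /word_of_path /oriented_steps => w /=; elim: w (0) => //= a w IHw x.
by rewrite letter_of_stepE /= IHw.
Qed.

Lemma word_of_pathK : cancel word_of_path path_of_word.
Proof.
case=> s sP; apply: val_inj; rewrite /= /word_of_path /oriented_steps /=.
elim: s (0) sP => //= y s IHs x /andP[/adjacentP[a Ey] sP].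
by rewrite Ey letter_of_stepE /= -Ey IHs.
Qed.

End Lattice.

(* Main.v *)
(* The endpoint of a path and its flow are additive under concatenation up to
   a translation of the flow by the first endpoint, so they factor through a
   metabelian quotient of the free group F: the endpoint is trivial on F', and
   the flow is then a homomorphism on F' to an abelian group, trivial on F''.
   Conversely, choose for each vertex x a word t(x) leading from 0 to x, and
   attach to the edge (x, i) the loop t(x) x_i t(x + e_i)^-1, which lies in F'.
   The product of these loops along a closed path w telescopes to the conjugate
   t(0) w t(0)^-1; if w has zero flow, each loop occurs in it as often as its
   inverse, so the product dies in the abelianization of F', i.e. w is in F''.
   The flow of a path determines its endpoint, because its divergence is the
   difference of the Dirac masses at 0 and at the endpoint. *)

Require Import Defs.
From HB Require Import structures.
From mathcomp Require Import all_boot all_order all_algebra.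
From mathcomp Require Import boolp classical_sets.

Set Implicit Arguments.
Unset Strict Implicit.
Unset Printing Implicit Defensive.

Import GRing.Theory.

(** * Exponent sums of words *)

Section Exponent.
Local Open Scope ring_scope.
Variable T : choiceType.
Implicit Types (a b : letter T) (w : word T) (x : T).

Definition exponent w x : int :=
  (count_mem (x, true) w)%:Z - (count_mem (x, false) w)%:Z.

Lemma exponent_cat u w x : exponent (u ++ w) x = exponent u x + exponent w x.
Proof. by rewrite /exponent !count_cat !PoszD opprD addrACA. Qed.

Lemma exponent_cons a w x : exponent (a :: w) x = exponent [:: a] x + exponent w x.
Proof. by rewrite -cat1s exponent_cat. Qed.

Lemma exponent1 a x : exponent [:: a] x = if a.1 == x then (-1) ^+ ~~ a.2 else 0.
Proof.
by case: a => y []; rewrite /exponent /= !xpair_eqE ?andbT ?andbF /=;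
  case: (y == x); rewrite ?expr0 ?expr1.
Qed.

Lemma exponent_linv a x : exponent [:: linv a] x = - exponent [:: a] x.
Proof. by rewrite !exponent1 /=; case: eqP; case: a => y []; rewrite ?opprK ?oppr0. Qed.

(** Otherwise every occurrence of [a.1] would carry the sign of [a], and nothing could offset the
    leading letter. *)
Lemma balanced_linv a w :
  (forall x, exponent (a :: w) x = 0) -> linv a \in w.
Proof.
move=> /(_ a.1); apply: contra_eqT => naw; case: a naw => x b.
rewrite /linv /= => /count_memPn naw.
rewrite exponent_cons exponent1 eqxx /exponent.
by case: b naw => /= ->; rewrite ?subr0 ?sub0r ?expr1 -?opprD ?oppr_eq0.
Qed.

End Exponent.

(** * Balanced words and derived subgroups *)

Section BalancedWord.
Local Open Scope group_scope.
Variables (T : choiceType) (G : groupType) (H : set G) (f : T -> G).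
Hypotheses (subH : is_subgroup H) (Hf : forall x, H (f x)).
Implicit Types (a : letter T) (u v w : word T).

Lemma eval_letter_linv a : eval_letter f (linv a) = (eval_letter f a)^-1.
Proof. by case: a => x []; rewrite /eval_letter //= invgK. Qed.

Lemma eval_word_cons a w : eval_word f (a :: w) = eval_letter f a * eval_word f w.
Proof. by rewrite /eval_word big_cons. Qed.

Lemma eval_letter_mem a : H (eval_letter f a).
Proof.
by have /subgroupP[_ _ HV] := subH; case: a => x []; [exact: Hf | apply/HV/Hf].
Qed.

Lemma eval_word_mem w : H (eval_word f w).
Proof.
have /subgroupP[H1 HM _] := subH.
elim: w => [|a w IHw]; first by rewrite /eval_word big_nil.
by rewrite eval_word_cons; apply: HM => //; apply: eval_letter_mem.
Qed.

(** Serves twice: with [H] the whole free group F it yields elements of F', and with [H] = F' and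
    the edge loops as [f] it yields elements of F''. *)
Lemma eval_balanced w :
  (forall x, exponent w x = 0%R) -> derived_subgroup H (eval_word f w).
Proof.
have /subgroupP[D1 DM _] := subgroup_gen [set [~ x, y] | x in H & y in H]%classic.
have /subgroupP[_ _ HV] := subH.
have [n] := ubnP (size w); elim: n w => // n IHn [|a w] ltn bal.
  by rewrite /eval_word big_nil.
have aw := balanced_linv bal; case/splitPr: aw bal ltn => u v bal ltn.
(* Up to the commutator of a and u, the letter a may be moved next to its
   inverse and cancelled. *)
have -> : eval_word f (a :: u ++ linv a :: v) =
          [~ (eval_letter f a)^-1, (eval_word f u)^-1] * eval_word f (u ++ v).
  rewrite !(eval_word_cons, eval_word_cat) eval_letter_linv commgEl /conjg.
  by rewrite !invgK !mulgA mulgVK.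
apply: DM; last apply: IHn => [|x].
- move=> B [_]; apply; exists (eval_letter f a)^-1.
    exact/HV/eval_letter_mem.
  by exists (eval_word f u)^-1; first exact/HV/eval_word_mem.
- by move: ltn; rewrite /= !size_cat /= addnS !ltnS; apply/leq_trans/leqnSn.
- have := bal x; rewrite exponent_cons exponent_cat (exponent_cons (linv a)).
  by rewrite exponent_linv addrCA addNKr exponent_cat.
Qed.

End BalancedWord.

Lemma eval_word_inv (T : choiceType) (G : groupType) (f : T -> G) w :
  eval_word f (word_inv w) = (eval_word f w)^-1%g.
Proof.
apply/esym/mulg1_eq; rewrite -eval_word_cat -eval_reduce reduce_mulV.
by rewrite /eval_word big_nil.
Qed.

Lemma derived_sub (G : groupType) (A B : set G) :
  is_subgroup B -> (forall x y, A x -> A y -> B [~ x, y]%g) ->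
  forall x, derived_subgroup A x -> B x.
Proof. by move=> sB AB x; apply; split=> // _ [u Au [v Av <-]]; apply: AB. Qed.

(** * Displacement and edge words *)

Section EdgeWord.
Local Open Scope ring_scope.
Variable d : nat.
Implicit Types (a : letter 'I_d) (u v w : word 'I_d) (x y : vertex d).
Implicit Types (g h : freeGroup 'I_d) (r : edge d).

Definition displacement w : vertex d := \sum_(a <- w) step a.

(** An edge is named by its base vertex, which for a negative step is the arrival point. *)
Definition edge_letter x a : letter (edge d) :=
  ((if a.2 then x else x + step a, a.1), a.2).

Fixpoint edge_word x w : word (edge d) :=
  if w is a :: w' then edge_letter x a :: edge_word (x + step a) w' else [::].

Lemma displacement_nil : displacement [::] = 0.
Proof. by rewrite /displacement big_nil. Qed.

Lemma displacement_cons a w : displacement (a :: w) = step a + displacement w.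
Proof. by rewrite /displacement big_cons. Qed.

Lemma displacement_cat u w : displacement (u ++ w) = displacement u + displacement w.
Proof. by rewrite /displacement big_cat. Qed.

Lemma step_linv a : step (linv a) = - step a.
Proof. by case: a => i []; rewrite /step //= opprK. Qed.

Lemma edge_letter_linv x a : edge_letter (x + step a) (linv a) = linv (edge_letter x a).
Proof. by rewrite /edge_letter step_linv addrK; case: a => i []. Qed.

Lemma displacement_reduce w : displacement (reduce w) = displacement w.
Proof.
elim: w => //= a w IHw; rewrite displacement_cons -IHw.
case: (reduce w) => [|b v] /=; first by rewrite displacement_cons.
case: eqP => [->|_]; rewrite !displacement_cons //.
by rewrite step_linv addNKr.
Qed.

Lemma displacement_inv w : displacement (word_inv w) = - displacement w.
Proof.
apply/eqP; rewrite -addr_eq0 -displacement_cat.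
by rewrite -displacement_reduce reduce_Vmul displacement_nil.
Qed.

Lemma edge_word_cat x u w :
  edge_word x (u ++ w) = edge_word x u ++ edge_word (x + displacement u) w.
Proof.
elim: u x => [|a u IHu] x /=; first by rewrite displacement_nil addr0.
by rewrite IHu displacement_cons addrA.
Qed.

(** The flow is written as an exponent sum over the alphabet of edges so that [eval_balanced]
    applies to it. *)
Definition edge_flow x w r : int := exponent (edge_word x w) r.

Lemma edge_flow_cons x a w r :
  edge_flow x (a :: w) r = exponent [:: edge_letter x a] r + edge_flow (x + step a) w r.
Proof. exact: exponent_cons. Qed.

Lemma edge_flow_cat x u w r :
  edge_flow x (u ++ w) r = edge_flow x u r + edge_flow (x + displacement u) w r.
Proof. by rewrite /edge_flow edge_word_cat exponent_cat. Qed.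

(** A cancelled pair crosses one edge forth and back and returns to the same vertex; hence the flow
    is well defined on the free group. *)
Lemma edge_flow_reduce x w r : edge_flow x (reduce w) r = edge_flow x w r.
Proof.
elim: w x => //= a w IHw x; rewrite edge_flow_cons -IHw.
case: (reduce w) => [|b v] /=; first by rewrite edge_flow_cons.
case: eqP => [->|_]; rewrite !edge_flow_cons // edge_letter_linv exponent_linv.
by rewrite step_linv addrK addNKr.
Qed.

Lemma displacement_exponent w i : displacement w 0 i = exponent w i.
Proof.
elim: w => [|a w IHw]; first by rewrite displacement_nil mxE.
rewrite displacement_cons mxE IHw exponent_cons exponent1; congr (_ + _).
case: a => j []; rewrite /step /= !mxE eqxx /= [i == j]eq_sym;
  by case: (j == i); rewrite ?oppr0.
Qed.

Lemma derived_displacement w :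
  displacement w = 0 -> derived_subgroup setT (eval_word (@fggen 'I_d) w).
Proof.
move=> w0; apply: eval_balanced => // [|i]; first by case: (normal_setT (freeGroup 'I_d)).
by rewrite -displacement_exponent w0 mxE.
Qed.

(** * Edge loops and membership in F'' *)

Definition word_to x : word 'I_d :=
  flatten [seq nseq `|x 0%R i|%N (i, 0 <= x 0 i) | i <- enum 'I_d].

Lemma displacement_word_to x : displacement (word_to x) = x.
Proof.
rewrite /displacement big_flatten big_map big_enum [RHS]row_sum_delta /=.
apply: eq_bigr => i _; rewrite big_nseq iter_addr_0 /step /= /basis_vec.
case: (x 0 i) => n /=; first by rewrite -scaler_nat natz.
by rewrite NegzE -scaler_nat natz scalerN scaleNr.
Qed.

(** Schreier generators of F' for the transversal [word_to] of F/F'. *)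
Definition loop r : freeGroup 'I_d :=
  let F := eval_word (@fggen 'I_d) in
  (F (word_to r.1) * fggen r.2 * (F (word_to (r.1 + basis_vec r.2)))^-1)%g.

Lemma loop_derived r : derived_subgroup setT (loop r).
Proof.
have -> : loop r = eval_word (@fggen 'I_d)
    (word_to r.1 ++ (r.2, true) :: word_inv (word_to (r.1 + basis_vec r.2))).
  by rewrite eval_word_cat eval_word_cons eval_word_inv mulgA.
apply: derived_displacement; rewrite displacement_cat displacement_cons.
by rewrite displacement_inv !displacement_word_to addrA subrr.
Qed.

Lemma eval_letter_loop x a :
  let F := eval_word (@fggen 'I_d) in
  eval_letter loop (edge_letter x a) =
  (F (word_to x) * eval_letter (@fggen _) a * (F (word_to (x + step a)))^-1)%g.
Proof.
case: a => i []; rewrite /eval_letter /loop //= subrK.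
by rewrite !invgM invgK mulgA.
Qed.

Lemma eval_edge_word x w :
  let F := eval_word (@fggen 'I_d) in
  eval_word loop (edge_word x w) =
  (F (word_to x) * F w * (F (word_to (x + displacement w)))^-1)%g.
Proof.
elim: w x => [|a w IHw] x /=.
  by rewrite /eval_word !big_nil displacement_nil addr0 mulg1 mulgV.
rewrite !eval_word_cons eval_letter_loop IHw displacement_cons addrA.
by rewrite !mulgA mulgVK.
Qed.

Lemma second_derived_flow0 w :
  displacement w = 0 -> (forall r, edge_flow 0 w r = 0) ->
  nsgset (second_derived d) (eval_word (@fggen 'I_d) w).
Proof.
move=> w0 flow0.
have /= D := eval_balanced (subgroup_gen _) loop_derived flow0.
have [_ nD] := nsgP (second_derived d).
(* Conjugation removes the two outer factors left by the telescoping product. *)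
have := nD _ (eval_word (@fggen _) (word_to 0)) D.
by rewrite eval_edge_word w0 addr0 /conjg !mulgA mulVg mul1g mulgVK.
Qed.

(** * Displacement and flow on F, F' and F'' *)

Lemma displacementM g h : displacement (g * h)%g = displacement g + displacement h.
Proof. by rewrite displacement_reduce displacement_cat. Qed.

Lemma displacementV g : displacement g^-1%g = - displacement g.
Proof. exact: displacement_inv. Qed.

Lemma derived_displacement0 g : derived_subgroup setT g -> displacement g = 0.
Proof.
move: g; refine (@derived_sub _ _
  [set g : freeGroup 'I_d | displacement g = 0]%classic _ _).
  apply/subgroupP; split=> /= [|g h g0 h0|g g0]; first exact: displacement_nil.
    by rewrite displacementM g0 h0 addr0.
  by rewrite displacementV g0 oppr0.
move=> g h _ _; rewrite /mkset commgEl /conjg !displacementM !displacementV.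
by rewrite addrCA addKr addNr.
Qed.

Lemma edge_flowM x g h r :
  edge_flow x (g * h)%g r = edge_flow x g r + edge_flow (x + displacement g) h r.
Proof. by rewrite edge_flow_reduce edge_flow_cat. Qed.

Lemma edge_flowV x g r :
  displacement g = 0 -> edge_flow x g^-1%g r = - edge_flow x g r.
Proof.
move=> g0; apply/eqP; rewrite eq_sym -subr_eq0 -opprD oppr_eq0.
by have := edge_flowM x g g^-1%g r; rewrite g0 addr0 mulgV => <-.
Qed.

(** The starting point is arbitrary because the theorem applies this from the endpoint of another
    path. *)
Lemma second_derived_edge_flow g : nsgset (second_derived d) g ->
  displacement g = 0 /\ forall x r, edge_flow x g r = 0.
Proof.
move: g; refine (@derived_sub _ _
  [set g : freeGroup 'I_d |
     displacement g = 0 /\ forall x r, edge_flow x g r = 0]%classic _ _).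
  apply/subgroupP; split=> /= [|g h [g0 gf] [h0 hf]|g [g0 gf]].
  - by split=> //; apply: displacement_nil.
  - split=> [|x r]; first by rewrite displacementM g0 h0 addr0.
    by rewrite edge_flowM gf hf addr0.
  - split=> [|x r]; first by rewrite displacementV g0 oppr0.
    by rewrite edge_flowV // gf oppr0.
(* Both entries of the commutator lie in F', so no translation occurs and the four contributions
   cancel. *)
move=> g h /derived_displacement0 g0 /derived_displacement0 h0.
have g'0 : displacement g^-1%g = 0 by rewrite displacementV g0 oppr0.
have h'0 : displacement h^-1%g = 0 by rewrite displacementV h0 oppr0.
split=> [|x r]; rewrite commgEl /conjg.
  by rewrite !displacementM g'0 h'0 g0 h0 !addr0.
rewrite !edge_flowM g'0 h'0 g0 !addr0 !edge_flowV //.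
by rewrite addrCA addKr addNr.
Qed.

(** * Lattice paths, and the divergence of their flow *)

Lemma Sol_valueE p : Sol_value p =
  quot_proj (second_derived d) (eval_word (@fggen 'I_d) (word_of_path p)).
Proof.
rewrite /Sol_value; elim: (word_of_path p) => [|a w IHw].
  by rewrite /eval_word !big_nil.
rewrite !eval_word_cons IHw -quot_projM; congr (quot_mul _ _).
case: a => i [] //=; exact: quot_projV.
Qed.

Lemma oriented_step_eq x a y b :
  ((x, x + step a) == (y, y + step b)) = (x == y) && (a == b).
Proof.
rewrite xpair_eqE; case: eqP => //= ->.
by rewrite (inj_eq (addrI _)) (inj_eq (@step_inj d)).
Qed.

Lemma flowE p r : flow p r = edge_flow 0 (word_of_path p) r.
Proof.
rewrite -{1}[p]word_of_pathK; move: (word_of_path p) => w.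
rewrite /flow /oriented_steps /=; case: r => y i.
elim: w (0) => //= a w IHw x; rewrite edge_flow_cons -IHw exponent1.
(* This presents the backward traversal as a step too, so that [oriented_step_eq] covers both
   counts. *)
have E : y = y + basis_vec i + step (i, false) by rewrite addrK.
have -> : ((x, x + step a) == (y, y + basis_vec i)) = (x == y) && (a == (i, true)).
  exact: (oriented_step_eq x a y (i, true)).
have -> : ((x, x + step a) == (y + basis_vec i, y)) =
          (x == y + basis_vec i) && (a == (i, false)).
  by rewrite {2}E oriented_step_eq.
case: a => j [] /=; rewrite !xpair_eqE /= ?andbT ?andbF ?add0n.
  by rewrite PoszD -addrA; case: ifP.
rewrite /step /= subr_eq PoszD opprD addrCA.
by congr (_ + _); case: (eqVneq j i) => [->|]; rewrite ?andbT ?andbF ?expr1 /=; case: eqP.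
Qed.

(** Net outflow at [y]: each step leaves its start and enters its end, so intermediate vertices
    cancel. *)
Lemma edge_flow_divergence x w y :
  \sum_(i < d) (edge_flow x w (y, i) - edge_flow x w (y - basis_vec i, i)) =
  (x == y)%:R - (x + displacement w == y)%:R.
Proof.
elim: w x => [|a w IHw] x.
  by rewrite displacement_nil addr0 subrr big1 // => i _; rewrite subrr.
under eq_bigr do rewrite !edge_flow_cons opprD addrACA.
rewrite big_split /= IHw displacement_cons addrA [x + (_ + _)]addrA; congr (_ - _).
(* The first step crosses an edge of direction [a.1] only. *)
rewrite (bigD1 a.1) //= big1 => [|i ia]; last first.
  by rewrite !exponent1 !xpair_eqE [a.1 == i]eq_sym (negPf ia) !andbF subrr.
rewrite addr0 !exponent1 !xpair_eqE eqxx !andbT.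
case: a => j [] /=; rewrite /step /=.
  have -> : (x == y - basis_vec j) = (x + basis_vec j == y).
    by rewrite eq_sym subr_eq eq_sym.
  by case: eqP; case: eqP => _ _; rewrite ?addrK ?subr0 ?add0r ?addNr.
rewrite (inj_eq (addIr _)).
by case: eqP; case: eqP => _ _; rewrite ?expr1 ?opprK ?oppr0 ?addr0 ?addNr ?subrK ?add0r.
Qed.

Lemma edge_flow_displacement u v :
  (forall r, edge_flow 0 u r = edge_flow 0 v r) -> displacement u = displacement v.
Proof.
move=> uv; apply/eqP; rewrite -[displacement u]add0r -[displacement v]add0r.
(* At the endpoint of [v] its end mass is 1; equal divergences force the end mass of [u] there to be
   1 as well. *)
have := edge_flow_divergence 0 u (0 + displacement v).
under eq_bigr do rewrite !uv.
by rewrite edge_flow_divergence eqxx => /addrI/oppr_inj; case: eqP.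
Qed.

(** The inverse word retraces the path backwards from its endpoint. *)
Lemma edge_flow_inv x v r :
  edge_flow (x + displacement v) (word_inv v) r = - edge_flow x v r.
Proof.
apply/eqP; rewrite -addr_eq0 addrC -edge_flow_cat.
by rewrite -edge_flow_reduce reduce_mulV.
Qed.

End EdgeWord.

Lemma fgword_eval_word (T : choiceType) (w : word T) :
  fgword (eval_word (@fggen T) w) = reduce w.
Proof.
elim: w => [|a w IHw]; first by rewrite /eval_word big_nil.
rewrite eval_word_cons /= IHw.
by rewrite [LHS]reduce_catr; case: a => x [].
Qed.

Theorem lemma2 (d : nat) (hd : (1 <= d)%N) (gamma1 gamma2 : lattice_path d) :
  Sol_equivalent gamma1 gamma2 <->
  forall rho : edge d, flow gamma1 rho = flow gamma2 rho.
Proof.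
pose F := eval_word (@fggen 'I_d).
pose u := word_of_path gamma1; pose v := word_of_path gamma2.
rewrite /Sol_equivalent !Sol_valueE -/F -/u -/v.
split=> [Euv r|Euv].
  have /quot_projE/second_derived_edge_flow[_ D] := Euv.
  (* The product is [F v], and its second factor, being in F'', adds no flow. *)
  have := edge_flowM 0%R (F u) ((F u)^-1 * F v)%g r.
  rewrite mulVKg D addr0 /F !fgword_eval_word !edge_flow_reduce.
  by rewrite !flowE => ->.
have {}Euv r : edge_flow 0%R u r = edge_flow 0%R v r by rewrite -!flowE.
have Duv := edge_flow_displacement Euv.
have D : nsgset (second_derived d) (F (v ++ word_inv u)).
  apply: second_derived_flow0 => [|r].
    by rewrite displacement_cat displacement_inv Duv subrr.
  by rewrite edge_flow_cat -Duv edge_flow_inv Euv subrr.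
have [_ nD] := nsgP (second_derived d).
(* Conjugating [F v * (F u)^-1] by [F u] gives the left-coset form [(F u)^-1 * F v]. *)
apply/quot_projE; have := nD _ (F u) D.
by rewrite /F eval_word_cat eval_word_inv /conjg mulgVK.
Qed.
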